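(* Let $\mathsf T$ be a productive closed-hereditary topological class of Hausdorff topological spaces. Every topological space $X$ has a $\mathsf T$-reflection $(\mathsf TX,i_X)$. Moreover, the $\mathsf T$-reflection is unique in the sense that for any other $\mathsf T$-reflection $(\mathsf T'X,i'_X)$ of $X$ there exists a unique homeomorphism $h:\mathsf TX\to\mathsf T'X$ such that $h\circ i_X=i'_X$.
   Context: A class $\mathsf T$ of topological spaces is: topological if for any $X\in\mathsf T$ and any homeomorphism $h:X\to Y$ the topological space $Y$ belongs to $\mathsf T$; closed-hereditary if for any $X\in\mathsf T$ all closed subspaces of $X$ belong to $\mathsf T$; productive if for any family $(X_\alpha)_{\alpha\in A}$ of spaces in $\mathsf T$ the Tychonoff product $\prod_{\alpha\in A}X_\alpha$ belongs to $\mathsf T$. A $\mathsf T$-reflection of a topological space $X$ is a pair $(\mathsf TX,i_X)$ consisting of a space $\mathsf TX\in\mathsf T$ and a continuous map $i_X:X\to\mathsf TX$ such that for any continuous map $f:X\to Y$ to a space $Y\in\mathsf T$ there exists a unique continuous map $\bar f:\mathsf TX\to Y$ such that $f=\bar f\circ i_X$. *)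

(* Defs.v *)
From mathcomp Require Import all_boot all_classical topology.

Set Implicit Arguments.
Unset Strict Implicit.
Unset Printing Implicit Defensive.

Local Open Scope classical_set_scope.

Definition homeomorphism (X Y : topologicalType) (h : X -> Y) : Prop :=
  exists g : Y -> X,
    [/\ continuous h, continuous g, cancel h g & cancel g h].

(* A class of spaces is a predicate on [topologicalType] and not a
   [set topologicalType], since [set] ranges over small types only.
   A [topologicalType] also carries a choice operator; [topological_class]
   makes membership independent of it, because the identity between two
   copies of a space with different choice operators is a homeomorphism. *)
Definition topological_class (T : topologicalType -> Prop) : Prop :=
  forall (X Y : topologicalType) (h : X -> Y),
    T X -> homeomorphism h -> T Y.

(* The topology on [set_type F] is the one induced from [X]; the library's
   [subspace F] would instead keep all points of [X]. *)
Definition closed_hereditary (T : topologicalType -> Prop) : Prop :=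
  forall (X : topologicalType) (F : set X),
    T X -> closed F -> T (set_type F).

Definition productive (T : topologicalType -> Prop) : Prop :=
  forall (A : Type) (X : A -> topologicalType),
    (forall a, T (X a)) -> T (prod_topology X).

Definition is_reflection (T : topologicalType -> Prop)
    (X TX : topologicalType) (iX : X -> TX) : Prop :=
  [/\ T TX,
      continuous iX
    & forall (Y : topologicalType) (f : X -> Y), T Y -> continuous f ->
        exists! fbar : TX -> Y, continuous fbar /\ f = fbar \o iX].

(* Main.v *)
Require Import Defs.
From mathcomp Require Import all_boot all_classical topology.

(** The reflection of [X] is the closure of the image of [X] in the product of
    the targets of all continuous maps from [X] to spaces of the class. To index
    this product by a type no larger than [X], note that the points [y] of the
    closure of [f X] in a Hausdorff space are determined by the traces
    [f^-1 U] of their neighbourhoods [U]; hence every such map factors through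
    one whose target is carried by a subset of the double power set of [X]. *)

Set Implicit Arguments.
Unset Strict Implicit.
Unset Printing Implicit Defensive.

Local Open Scope classical_set_scope.

Lemma prod_topology_proj_continuous (I : Type) (K : I -> topologicalType)
    (i : I) :
  continuous (fun g : prod_topology K => g i).
Proof.
(* The product topology is the supremum of the initial topologies of the projections, so its
   neighbourhood filter refines each of theirs. *)
move=> g; have gi : nbhs g --> (g : initial_topology (@^~ i)).
  by have /cvg_sup/(_ i) : nbhs g --> g by exact: cvg_id.
by move=> A /initial_continuous /gi.
Qed.

Lemma prod_topology_continuous (I : Type) (K : I -> topologicalType)
    (Z : topologicalType) (f : Z -> prod_topology K) :
  (forall i, continuous (fun z => f z i)) -> continuous f.
Proof.
move=> fc z; apply/cvg_sup => i.
apply: (@continuous_comp_initial _ Z (K i)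
  (fun g : prod_topology K => g i) f) => /=; exact: fc.
Qed.

Lemma dense_range_continuous_eq (X : Type) (Y Z : topologicalType)
    (e : X -> Y) (f g : Y -> Z) :
  hausdorff_space Z -> dense (range e) -> continuous f -> continuous g ->
  f \o e = g \o e -> f = g.
Proof.
move=> ZH ed fc gc fg; apply/funext => y; apply: ZH => A B Af Bg.
have /nbhs_interior yAB : nbhs y (f @^-1` A `&` g @^-1` B).
  by apply: filterI; [exact: fc|exact: gc].
have [||z [/interior_subset[/= fA gB] [x _ xz]]] :=
    ed ((f @^-1` A `&` g @^-1` B)^°).
- by exists y; exact: nbhs_singleton yAB.
- exact: open_interior.
exists (f (e x)); split; first by rewrite xz.
by rewrite -[f (e x)]/((f \o e) x) fg /= xz.
Qed.

Definition closure_corestriction (X : Type) (Y : topologicalType) (f : X -> Y)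
    (x : X) : set_type (closure (range f)) :=
  SigSub (mem_set (subset_closure (imageT f x))).

Lemma closure_corestriction_continuous (X Y : topologicalType) (f : X -> Y) :
  continuous f -> continuous (closure_corestriction f).
Proof.
move=> fc; apply: continuous_comp_initial.
rewrite (_ : _ \o _ = f) //; by apply/funext => x /=; rewrite set_valE.
Qed.

Lemma closure_corestriction_dense (X : Type) (Y : topologicalType)
    (f : X -> Y) :
  dense (range (closure_corestriction f)).
Proof.
move=> O [y Uy] [U Uo UO]; rewrite -{}UO in Uy *; have /set_mem yf := valP y.
have [|_ [[x _ <-] Ux]] := yf U.
  by apply: open_nbhs_nbhs; split => //; move: Uy; rewrite /= set_valE.
exists (closure_corestriction f x); split; last by exists x.
by rewrite /= set_valE.
Qed.

Definition nbhs_trace (X : Type) (Y : topologicalType) (f : X -> Y) (y : Y) :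
  set (set X) := [set f @^-1` U | U in nbhs y].

(** If [U] is a neighbourhood of [y], equality of traces gives a neighbourhood [W] of [z] with the
    same preimage as [U]. For any neighbourhood [V] of [z], the set [W] [&] [V] contains some [f x],
    and this point lies in [U] too. So [y] and [z] cannot be separated. *)
Lemma nbhs_trace_inj (X : Type) (Y : topologicalType) (f : X -> Y) (y z : Y) :
  hausdorff_space Y -> closure (range f) z ->
  nbhs_trace f y = nbhs_trace f z -> y = z.
Proof.
move=> YH zf yz; apply: YH => U V yU zV.
have [W zW fWU] : nbhs_trace f z (f @^-1` U) by rewrite -yz; exists U.
have [_ [[x _ <-] [Wx Vx]]] := zf _ (filterI zW zV).
exists (f x); split => //.
by rewrite -[U _]/((f @^-1` U) x) -fWU.
Qed.

(** The index type of the product. Storing a subset of the fixed type [set (set X)] and a topology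
    on it, rather than an arbitrary [topologicalType], keeps the record in a universe where the
    product is again a space to which [T] applies. *)
Record small_map (T : topologicalType -> Prop) (X : topologicalType) := SmallMap {
  carrier : set (set (set X));
  carrier_topology : Topological (set_type carrier);
  target : topologicalType := Topological.Pack carrier_topology;
  map_to : X -> target;
  target_in : T target;
  map_to_continuous : continuous map_to }.

Lemma small_map_factor (T : topologicalType -> Prop) (X Y : topologicalType)
    (f : X -> Y) :
  topological_class T -> closed_hereditary T -> hausdorff_space Y ->
  T Y -> continuous f ->
  exists (a : small_map T X) (k : target a -> Y),
    continuous k /\ f = k \o map_to a.
Proof.
move=> Ttop Tclosed YH TY fc.
pose C := set_type (closure (range f)).
pose code (y : C) := nbhs_trace f (val y).
have code_inj : injective code.
  move=> y z /(nbhs_trace_inj YH (set_mem (valP z))); exact: val_inj.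
pose D := range code.
have decodeP (d : set_type D) : {y : C | code y = val d}.
  by apply: cid; have /set_mem[y _ <-] := valP d; exists y.
pose decode d := sval (decodeP d).
pose encode (y : C) : set_type D := SigSub (mem_set (imageT code y)).
have encodeK : cancel encode decode.
  by move=> y; apply: code_inj; rewrite /decode (svalP (decodeP _)).
have decodeK : cancel decode encode.
  by move=> d; apply: val_inj; rewrite /= (svalP (decodeP d)).
(* Pulling the topology of [C] back along the bijection [decode] makes [W] a homeomorphic copy of
   [C], so [W] inherits membership in [T]. *)
pose W : topologicalType := initial_topology decode.
have decode_continuous : continuous (decode : W -> C).
  exact: initial_continuous.
have encode_continuous : continuous (encode : C -> W).
  apply: continuous_comp_initial; rewrite (_ : _ \o _ = id).
    by move=> y; exact: cvg_id.
  by apply/funext.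
have TW : T W.
  apply: (Ttop C W encode); last by exists decode.
  by apply: Tclosed => //; exact: closed_closure.
have gc : continuous (encode \o closure_corestriction f : X -> W).
  move=> x; apply: continuous_comp; last exact: encode_continuous.
  exact: closure_corestriction_continuous.
(* The target of this small map is [W] itself up to conversion; the factor to [Y] decodes and then
   includes the closure in [Y]. *)
exists (@SmallMap T X D (Topological.class W) _ TW gc), (set_val \o decode).
split.
  move=> d; apply: continuous_comp; first exact: decode_continuous.
  exact: initial_continuous.
by apply/funext => x /=; rewrite encodeK set_valE.
Qed.

Lemma exists_reflection (T : topologicalType -> Prop) (X : topologicalType) :
  topological_class T -> closed_hereditary T -> productive T ->
  (forall Y : topologicalType, T Y -> hausdorff_space Y) ->
  exists (TX : topologicalType) (iX : X -> TX), is_reflection T iX.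
Proof.
move=> Ttop Tclosed Tprod TH.
pose P : topologicalType := prod_topology (@target T X).
pose e (x : X) : P := fun a => map_to a x.
have ec : continuous e.
  by apply: prod_topology_continuous => a; exact: map_to_continuous.
exists (set_type (closure (range e))), (closure_corestriction e); split.
- apply: Tclosed; last exact: closed_closure.
  by apply: Tprod => a; exact: target_in.
- exact: closure_corestriction_continuous.
move=> Y f TY fc.
have [a [k [kc fk]]] := small_map_factor Ttop Tclosed (TH Y TY) TY fc.
pose TX : topologicalType := set_type (closure (range e)).
(* The map [f] factors through the small map [a], which is the coordinate [a] of [e]; so project to
   that coordinate and apply [k]. *)
pose fbar (z : TX) := k (set_val z a).
have vac : continuous (fun z : TX => (set_val z : P) a).
  move=> z; apply: (@continuous_comp TX P _ set_val (fun g : P => g a)).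
    exact: initial_continuous.
  exact: prod_topology_proj_continuous.
have fbarc : continuous fbar.
  by move=> z; apply: (continuous_comp (@vac z)); exact: kc.
have fE : f = fbar \o closure_corestriction e.
  by apply/funext => x; rewrite fk /fbar /= set_valE.
exists fbar; split=> // g [gc fg].
(* Uniqueness: both extensions agree on the image of [X], which is dense in its closure, and [Y] is
   Hausdorff. *)
apply: (dense_range_continuous_eq (TH Y TY)
  (@closure_corestriction_dense _ _ e) fbarc gc).
by rewrite -fE.
Qed.

(** Both [h] and [id] factor [iX] through itself, so the uniqueness clause identifies them. This
    makes the two comparison maps between reflections mutually inverse. *)
Lemma reflection_endo_id (T : topologicalType -> Prop) (X TX : topologicalType)
    (iX : X -> TX) (h : TX -> TX) :
  is_reflection T iX -> continuous h -> h \o iX = iX -> h = id.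
Proof.
move=> [TTX ic iU] hc hi; have [g [_ gU]] := iU TX iX TTX ic.
rewrite -(gU h) //; apply: gU; split=> //.
by move=> x; exact: cvg_id.
Qed.

Lemma reflection_unique (T : topologicalType -> Prop)
    (X TX TX' : topologicalType) (iX : X -> TX) (iX' : X -> TX') :
  is_reflection T iX -> is_reflection T iX' ->
  exists! h : TX -> TX', homeomorphism h /\ h \o iX = iX'.
Proof.
move=> iR iR'; have [TTX ic iU] := iR; have [TTX' ic' iU'] := iR'.
have [h [[hc hi] hU]] := iU TX' iX' TTX' ic'.
have [g [[gc gi] _]] := iU' TX iX TTX ic.
have ghc : continuous (g \o h).
  by move=> x; apply: continuous_comp; [exact: hc|exact: gc].
have hgc : continuous (h \o g).
  by move=> x; apply: continuous_comp; [exact: gc|exact: hc].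
have gh : g \o h = id.
  by apply: (reflection_endo_id iR ghc); rewrite -compA -hi -gi.
have hg : h \o g = id.
  by apply: (reflection_endo_id iR' hgc); rewrite -compA -gi -hi.
exists h; split.
  split=> //; exists g; split=> //.
    by move=> x; rewrite -[LHS]/((g \o h) x) gh.
  by move=> x; rewrite -[LHS]/((h \o g) x) hg.
by move=> h' [[g' [h'c _ _ _]] h'i]; apply: hU.
Qed.

Theorem theorem2p1 (T : topologicalType -> Prop)
  (T_topological : topological_class T)
  (T_closed_hereditary : closed_hereditary T)
  (T_productive : productive T)
  (T_hausdorff : forall X : topologicalType, T X -> hausdorff_space X)
  (X : topologicalType) :
  (exists (TX : topologicalType) (iX : X -> TX), is_reflection T iX) /\
  (forall (TX : topologicalType) (iX : X -> TX)
          (TX' : topologicalType) (iX' : X -> TX'),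
     is_reflection T iX -> is_reflection T iX' ->
     exists! h : TX -> TX', homeomorphism h /\ h \o iX = iX').
Proof.
split; first exact: exists_reflection.
by move=> TX iX TX' iX'; exact: reflection_unique.
Qed.
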